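(* Let $T=(V,E)$ be a tree which is not a path. For every $k\in\{1,\ldots,\varsigma(T)\}$, $$\operatorname{pd}_k(T)\le k\kappa+\mathcal{I}_k(T)+1,$$ where $\kappa=|\mathcal{M}(T)|$.
   Context: All graphs are finite, simple, connected and have at least two vertices; $d$ is the shortest-path distance. Partition dimension: for a vertex $a$ and a nonempty vertex set $S$, $d(a,S)=\min_{v\in S}d(a,v)$; $S$ distinguishes different vertices $x,y$ if $d(x,S)\neq d(y,S)$. A partition $\Pi$ of the vertex set (into nonempty sets) is a $k$-partition generator if every pair of different vertices is distinguished by at least $k$ of the sets of $\Pi$. The $k$-partition dimension $\operatorname{pd}_k(T)$ is the minimum cardinality of a $k$-partition generator of $T$ (these exist for all $k\in\{1,\ldots,\varsigma(T)\}$, with $\varsigma(T)$ as defined below). Tree notions: a major vertex is a vertex of degree at least three. An end vertex (vertex of degree one) $u$ is a terminal vertex of a major vertex $v$ if $d(u,v)<d(u,w)$ for every other major vertex $w$. $U(v)$ denotes the set of terminal vertices of $v$, and the terminal degree of $v$ is $\operatorname{ter}(v)=|U(v)|$. $\mathcal{M}(T)$ is the set of major vertices of $T$ having terminal degree greater than one. For $w\in\mathcal{M}(T)$ and $u\in U(w)$ let $l(u,w)=d(u,w)$ be the length of the shortest path from $u$ to $w$. For different $u,v\in U(w)$ let $\varsigma(u,v)=l(u,w)+l(v,w)$ be the length of the path from $u$ to $v$ through $w$. Put $\varsigma(w)=\min_{u,v\in U(w),u\neq v}\varsigma(u,v)$, $l(w)=\min_{u\in U(w)}l(u,w)$ and $\varsigma(T)=\min_{w\in\mathcal{M}(T)}\varsigma(w)$.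 The parameter $\mathcal{I}_k(T)$: let $l_1<l_2<\cdots<l_r$ be the distinct values of $l(w)$ for $w\in\mathcal{M}(T)$, and let $\mathcal{M}_i(T)=\{w\in\mathcal{M}(T): l(w)=l_i\}$ for $1\le i\le r$. Let $t_i=\max_{w\in\mathcal{M}_i(T)}|U(w)|$. For $k\in\{1,\ldots,\varsigma(T)\}$ let $s_k$ be the maximum subscript such that $l_{s_k}\le\lfloor k/2\rfloor$; if $l_1>\lfloor k/2\rfloor$, put $s_k=1$. With the convention that $\max_{s_k<j\le r}\{t_j\}=0$ when $s_k=r$, define $$\mathcal{I}_k(T)=(t_1-2)\max\left\{k-l_1,\left\lceil\tfrac{k}{2}\right\rceil\right\}+\sum_{i=2}^{s_k}\max\left\{t_i-\max_{1\le j<i}\{t_j\},0\right\}(k-l_i)+\max\left\{\max_{s_k<j\le r}\{t_j\}-\max_{1\le j\le s_k}\{t_j\},0\right\}\left\lceil\tfrac{k}{2}\right\rceil.$$ *)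

(* Defs.v *)
(* A graph on the vertex type [T] is its adjacency relation [e : rel T]. *)
From mathcomp Require Import all_boot.

Set Implicit Arguments.
Unset Strict Implicit.
Unset Printing Implicit Defensive.

(* Minimum of a nonempty sequence of naturals (0 on the empty one). *)
Definition minseq (s : seq nat) : nat := foldr minn (head 0 s) s.

Lemma minseq_le (s : seq nat) (n : nat) : n \in s -> minseq s <= n.
Proof.
rewrite /minseq; elim: s (head 0 s) => //= m s IHs a.
rewrite inE geq_min => /orP[/eqP-> | /(IHs a) ->]; first by rewrite leqnn.
by rewrite orbT.
Qed.

Lemma minseq_mem (s : seq nat) : s != [::] -> minseq s \in s.
Proof.
case: s => // a s _; rewrite /minseq /=.
have foldr_mem: foldr minn a s \in a :: s.
  elim: s => [|m s IHs] /=; first by rewrite inE.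
  move: IHs; rewrite !inE /minn; case: ifP => _; first by rewrite eqxx orbT.
  by case/orP=> ->; rewrite ?orbT.
by rewrite {1}/minn; case: ifP => _; rewrite ?mem_head.
Qed.

Definition is_tree (T : finType) (e : rel T) : Prop :=
  [/\ 1 < #|T|,
      symmetric e,
      irreflexive e,
      forall x y, connect e x y
    & forall c : seq T, ucycle e c -> size c <= 2].

Definition is_path_graph (T : finType) (e : rel T) : Prop :=
  exists n (f : T -> 'I_n),
    bijective f /\
    forall x y, e x y = (f y == (f x).+1 :> nat) || (f x == (f y).+1 :> nat).

(* A walk with [n] edges from [x] is [x :: p] with [size p = n].  A shortest
   path has fewer than [#|T|] edges, so the default value [#|T|] is only
   reached when [x] and [y] are not connected. *)
Definition dist (T : finType) (e : rel T) (x y : T) : nat :=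
  \big[minn/#|T|]_(n < #|T| |
     [exists p : n.-tuple T, path e x p && (last x p == y)]) n.

Definition dist_set (T : finType) (e : rel T) (a : T) (S : {set T}) : nat :=
  minseq [seq dist e a v | v in S].

Definition distinguishes (T : finType) (e : rel T) (S : {set T}) (x y : T)
    : bool :=
  dist_set e x S != dist_set e y S.

Definition k_partition_generator (T : finType) (e : rel T) (k : nat)
    (P : {set {set T}}) : bool :=
  partition P [set: T] &&
  [forall x, forall y, (x != y) ==>
     (k <= #|[set S in P | distinguishes e S x y]|)].

(* [is_pd e k m] states that the k-partition dimension exists and equals [m];
   a relation is used so that no junk value is needed when there is no
   k-partition generator. *)
Definition is_pd (T : finType) (e : rel T) (k m : nat) : Prop :=
  (exists2 P : {set {set T}}, k_partition_generator e k P & #|P| = m) /\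
  (forall P : {set {set T}}, k_partition_generator e k P -> m <= #|P|).

Definition degree (T : finType) (e : rel T) (v : T) : nat :=
  #|[set w | e v w]|.

Definition major (T : finType) (e : rel T) (v : T) : bool := 3 <= degree e v.

Definition end_vertex (T : finType) (e : rel T) (u : T) : bool :=
  degree e u == 1.

Definition terminal (T : finType) (e : rel T) (u v : T) : bool :=
  [&& end_vertex e u, major e v
    & [forall w, (major e w && (w != v)) ==> (dist e u v < dist e u w)]].

Definition terminals (T : finType) (e : rel T) (v : T) : {set T} :=
  [set u | terminal e u v].

Definition ter (T : finType) (e : rel T) (v : T) : nat := #|terminals e v|.

Definition Mset (T : finType) (e : rel T) : {set T} :=
  [set w | major e w && (1 < ter e w)].

Definition varsigma_vertex (T : finType) (e : rel T) (w : T) : nat :=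
  minseq [seq dist e p.1 w + dist e p.2 w | p in
    [set p : T * T | [&& p.1 \in terminals e w, p.2 \in terminals e w
                       & p.1 != p.2]]].

Definition varsigma (T : finType) (e : rel T) : nat :=
  minseq [seq varsigma_vertex e w | w in Mset e].

Definition lmin (T : finType) (e : rel T) (w : T) : nat :=
  minseq [seq dist e u w | u in terminals e w].

Definition lvals (T : finType) (e : rel T) : seq nat :=
  sort leq (undup [seq lmin e w | w in Mset e]).

(* [l_idx e i], [M_idx e i] and [t_idx e i] stand for l_i, M_i(T) and t_i; they
   are meaningful for 1 <= i <= r, where [r = size (lvals e)]. *)
Definition l_idx (T : finType) (e : rel T) (i : nat) : nat :=
  nth 0 (lvals e) i.-1.

Definition M_idx (T : finType) (e : rel T) (i : nat) : {set T} :=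
  [set w in Mset e | lmin e w == l_idx e i].

Definition t_idx (T : finType) (e : rel T) (i : nat) : nat :=
  \max_(w in M_idx e i) ter e w.

Definition s_idx (T : finType) (e : rel T) (k : nat) : nat :=
  if k./2 < l_idx e 1 then 1
  else \max_(1 <= i < (size (lvals e)).+1 | l_idx e i <= k./2) i.

(* Truncated subtraction agrees with the integer one here when [Mset e] is
   nonempty: t_1 >= 2 by definition of [Mset]; [maxn (k - l_1) (uphalf k)] is
   not affected by replacing a negative first argument by 0; l_i <= k./2 for
   2 <= i <= s_k; and the differences of the t's are the positive parts
   max{_, 0}.  Maxima over empty index ranges are 0. *)
Definition Ik (T : finType) (e : rel T) (k : nat) : nat :=
  let s := s_idx e k in
  let r := size (lvals e) in
  (t_idx e 1 - 2) * maxn (k - l_idx e 1) (uphalf k)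
  + \sum_(2 <= i < s.+1)
      (t_idx e i - \max_(1 <= j < i) t_idx e j) * (k - l_idx e i)
  + (\max_(s.+1 <= j < r.+1) t_idx e j - \max_(1 <= j < s.+1) t_idx e j)
    * uphalf k.

(* Main.v *)
(** Call "legs" of a major vertex w the paths joining w (excluded) to its terminal vertices. For
    w in M(T), order the legs of w with a shortest one first, and colour on the first leg the
    min(l(w), k/2) vertices closest to w, on each other leg the k - min(l(w), k/2) closest ones.
    The k colours of the first two legs are private to w; on the j-th leg, j > 2, the colour is
    (j, distance to w), whatever w is. All other vertices form one more class. Two legs of w
    always carry at least k colours.

    Vertices x, y at odd distance are distinguished by every singleton, hence by the k private
    colours of any w. Otherwise let m be the middle of the x-y path; a singleton {v} distinguishes
    x, y as soon as v lies in the branch at m of x or of y. If one of these branches meets M(T), it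
    contains two legs of some w in M(T), except possibly when m itself lies on a leg of w; then m
    has degree two, the two branches cover T - m, and one uses another vertex of M(T) or, failing
    that, two other legs of w, all coloured classes being singletons. If neither branch meets
    M(T), both are legs of m and x, y are equidistant from m: a class meeting these legs at v has
    all its other vertices farther from m than v, so it still distinguishes x and y. *)
Require Import Defs.
From mathcomp Require Import all_boot zify.

Set Implicit Arguments.
Unset Strict Implicit.
Unset Printing Implicit Defensive.

(* [lia] treats every boolean atom of the context as a case split. *)
Ltac dlia := repeat match goal with
  | H : is_true (leq _ _) |- _ => revert H
  | H : is_true (~~ leq _ _) |- _ => revert H
  | H : @eq ?A _ _ |- _ => unify A nat; revert H
  | H : _ \/ _ |- _ => revert H
  end; clear; lia.

(** * Minima with a default value *)

Lemma minn_big_mem (I : Type) (r : seq I) (P : pred I) (F : I -> nat) (N : nat) :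
  (exists2 i, P i & \big[minn/N]_(i <- r | P i) F i = F i) \/
  \big[minn/N]_(i <- r | P i) F i = N.
Proof.
elim/big_rec: _ => [|i m Pi IHm]; first by right.
by rewrite /minn; case: ltnP => _ //; left; exists i.
Qed.

Lemma minn_big_le (I : eqType) (r : seq I) (P : pred I) (F : I -> nat) (N : nat) i :
  i \in r -> P i -> \big[minn/N]_(j <- r | P j) F j <= F i.
Proof.
elim: r => // j r IHr; rewrite inE big_cons => /predU1P[<- -> | ir Pi].
  exact: geq_minl.
by case: ifP => _; rewrite ?geq_min IHr ?orbT.
Qed.

(** * The shortest-path metric of a connected graph *)

Section Metric.

Variables (T : finType) (e : rel T).
Hypothesis sym : symmetric e.
Hypothesis irr : irreflexive e.
Hypothesis conn : forall x y, connect e x y.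
Local Notation d := (dist e).

Lemma dist_path_le x p : path e x p -> d x (last x p) <= size p.
Proof.
move=> ep; have [lt_p | le_p] := ltnP (size p) #|T|.
  apply: (@minn_big_le _ _ _ _ _ (Ordinal lt_p)); first exact: mem_index_enum.
  by apply/existsP; exists (in_tuple p); rewrite ep eqxx.
(* So long a walk is outside the index range, but the minimum never exceeds its default [#|T|]. *)
apply: leq_trans le_p; rewrite /dist.
by elim/big_rec: _ => // i m _; rewrite geq_min orbC => ->.
Qed.

(** A walk without repeated vertices has fewer than [#|T|] edges, so the default in [dist] is not
    reached and the minimum is attained. *)
Lemma dist_pathP x y : exists p, [/\ path e x p, last x p = y & size p = d x y].
Proof.
have /connectP[p0 ep0 ->] := conn x y; case/shortenP: ep0 => p ep Up _.
have ltp : d x (last x p) < #|T|.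
  by apply: leq_ltn_trans (dist_path_le ep) _; by have := max_card [in x :: p]; rewrite (card_uniqP Up).
set z := last x p in ltp *.
have [[i /existsP[q /andP[eq /eqP lq]] di] | di] := minn_big_mem (index_enum 'I_#|T|)
    (fun n : 'I_#|T| => [exists p : n.-tuple T, path e x p && (last x p == z)])
    (fun n => n) #|T|.
  by exists q; rewrite size_tuple /dist di.
by rewrite /dist di ltnn in ltp.
Qed.

Lemma dist_refl x : d x x = 0.
Proof. by apply/eqP; rewrite -leqn0; apply: (@dist_path_le x [::]). Qed.

Lemma dist_eq0 x y : d x y = 0 -> x = y.
Proof. by have [[|? ?] [_ <- <-]] := dist_pathP x y. Qed.

Lemma dist_gt0 x y : (0 < d x y) = (x != y).
Proof.
by case: eqVneq => [-> | neq]; rewrite ?dist_refl // lt0n; apply: contraNneq neq => /dist_eq0->.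
Qed.

Lemma dist_triangle y x z : d x z <= d x y + d y z.
Proof.
have [p [ep lp <-]] := dist_pathP x y; have [q [eq lq <-]] := dist_pathP y z.
rewrite -size_cat -lq -lp -last_cat; apply: dist_path_le.
by rewrite cat_path ep lp.
Qed.

Lemma dist_sym x y : d x y = d y x.
Proof.
suff le_d u v : d u v <= d v u by apply/eqP; rewrite eqn_leq !le_d.
have [p [ep <- <-]] := dist_pathP v u; case/lastP: p ep => [|p z] ep.
  by rewrite dist_refl.
have := @dist_path_le z (rev (v :: p)); rewrite last_rcons size_rev size_rcons /=.
rewrite rev_cons last_rcons -rev_cons; apply.
by have := rev_path e v (rcons p z); rewrite last_rcons belast_rcons (@eq_path _ _ e) // => ->.
Qed.

Lemma edge_dist1 x y : e x y -> d x y = 1.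
Proof.
move=> exy; apply/eqP; rewrite eqn_leq dist_gt0.
have := @dist_path_le x [:: y]; rewrite /= andbT => -> //.
by apply/eqP=> eqxy; rewrite eqxy irr in exy.
Qed.

Lemma dist_step x y : x != y -> exists2 z, e x z & d x y = (d z y).+1.
Proof.
move=> neq; have [[|z p] [/= ep lp sp]] := dist_pathP x y; first by rewrite lp eqxx in neq.
have /andP[exz ezp] := ep; exists z => //; apply/eqP; rewrite eqn_leq; apply/andP; split.
  by have := dist_triangle z x y; rewrite (edge_dist1 exz).
by rewrite -sp ltnS -lp dist_path_le.
Qed.

Lemma geodesic_point x y i : i <= d x y -> exists2 z, d x z = i & d x y = i + d z y.
Proof.
elim: i => [|i IHi] lei; first by exists x; rewrite ?dist_refl.
have [|z dz dy] := IHi; first dlia.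
have [|z' ezz' dz'] := @dist_step z y; first by rewrite -dist_gt0; dlia.
exists z'; last dlia.
have := dist_triangle z x z'; have := dist_triangle z' x y; rewrite (edge_dist1 ezz'); dlia.
Qed.

(** * Trees: edges are bridges and geodesics are unique *)

Section Tree.

Hypothesis acyclic : forall c : seq T, ucycle e c -> size c <= 2.

(** Comparing unordered pairs removes both orientations of the edge at once. *)
Definition del_edge a b : rel T := [rel u v | e u v && ([set u; v] != [set a; b])].

(** A path avoiding the edge would close up with it to a cycle of length at least three. *)
Lemma edge_bridge a b : e a b -> ~~ connect (del_edge a b) a b.
Proof.
move=> eab; apply/negP=> /connectP[p0 ep0 lb].
case/shortenP: ep0 lb => p ep Up _ lb.
have sub : subrel (del_edge a b) e by move=> u v /= /andP[].
have := acyclic (c := a :: p); rewrite /ucycle /cycle rcons_path (sub_path sub ep) /= -lb sym eab.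
case: p ep Up lb => [|c [|c' p]] //=.
- by move=> _ _ eqba; rewrite eqba irr in eab.
- by rewrite andbT => /andP[_ neq] _ eqb; rewrite eqb eqxx in neq.
by move=> _ -> _ /(_ isT).
Qed.

(* A geodesic from the nearer endpoint's side never uses the edge. *)
Lemma edge_near_connect a b v : d v a <= d v b -> connect (del_edge a b) v a.
Proof.
move En: (d v a) => n; elim: n v En => [|n IHn] v dva lev.
  by rewrite (dist_eq0 dva).
have [|z evz dz] := @dist_step v a; first by rewrite -dist_gt0; dlia.
have ub := dist_triangle z v b; rewrite (edge_dist1 evz) in ub.
apply: connect_trans (IHn z _ _); try dlia.
apply: connect1; rewrite /del_edge /= evz; apply/eqP=> eqs.
have: v \in [set a; b] by rewrite -eqs set21.
case/set2P=> eqv; first by rewrite eqv dist_refl in dva.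
by rewrite eqv dist_refl in lev.
Qed.

Lemma del_edge_sym a b : connect_sym (del_edge a b).
Proof. by apply: sym_connect_sym => u w; rewrite /del_edge /= sym setUC. Qed.

(** At equal distances, geodesics would join [v] to both ends without using the bridge [ab]. *)
Lemma edge_dist_neq a b v : e a b -> d v a != d v b.
Proof.
move=> eab; apply: contraNneq (edge_bridge eab) => eqd.
rewrite (connect_trans (y := v)) //; first by rewrite del_edge_sym edge_near_connect // eqd.
by rewrite /del_edge setUC; apply: (@edge_near_connect b a); rewrite eqd.
Qed.

Lemma edge_dist a b v : e a b -> d v a = (d v b).+1 \/ d v b = (d v a).+1.
Proof.
move=> eab; have da := dist_triangle b v a; have db := dist_triangle a v b.
rewrite (edge_dist1 eab) in db; rewrite (dist_sym b) (edge_dist1 eab) in da.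
have := edge_dist_neq v eab; dlia.
Qed.

(** A geodesic from [x] to [y] must cross the bridge; the induction follows it from [x] up to the
    crossing step, which can only go from [a] to [b]. *)
Lemma edge_split a b x y : e a b -> d x a < d x b -> d y b < d y a ->
  d x y = d x a + (d y b).+1.
Proof.
move=> eab xa yb; apply/eqP; rewrite eqn_leq; apply/andP; split.
  have := dist_triangle a x y; have := dist_triangle b a y.
  by rewrite (edge_dist1 eab) (dist_sym b); dlia.
move En: (d x y) => n; elim: n x xa En => [|n IHn] x xa dxy.
  by rewrite (dist_eq0 dxy) in xa; dlia.
have [|z exz dz] := @dist_step x y; first by rewrite -dist_gt0; dlia.
have [za | bz] := ltnP (d z a) (d z b).
  have := IHn z za; have := dist_triangle z x a; rewrite (edge_dist1 exz); dlia.
have xcon : connect (del_edge a b) x a by apply: edge_near_connect; dlia.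
have zcon : connect (del_edge a b) z b.
  by rewrite /del_edge setUC; apply: (@edge_near_connect b a).
have [/eqP eqs | neq] := boolP ([set x; z] == [set a; b]); last first.
  case/negP: (edge_bridge eab); apply: connect_trans zcon.
  rewrite del_edge_sym in xcon; apply: connect_trans xcon _.
  by apply: connect1; rewrite /del_edge /= exz.
have: x \in [set a; b] by rewrite -eqs set21.
have: z \in [set a; b] by rewrite -eqs set22.
case/set2P=> eqz; first by rewrite eqz dist_refl (edge_dist1 eab) in bz.
case/set2P=> eqx; last by rewrite eqx dist_refl in xa.
by move: dz dxy; rewrite eqx eqz dist_refl (dist_sym y); dlia.
Qed.

(** If [a != b], then [b] lies across the edge [am] from [v], hence at distance [d v a + 2], which
    exceeds [d v m]. *)
Lemma toward_uniq m a b v : e m a -> e m b -> d v a < d v m -> d v b < d v m -> a = b.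
Proof.
move=> ema emb va vb; apply/eqP; rewrite -[_ == _]negbK -dist_gt0; apply/negP=> ab.
have bm : d b m < d b a.
  by have := edge_dist b ema; rewrite (dist_sym b m) (edge_dist1 emb) (dist_sym b a); dlia.
have eam : e a m by rewrite sym.
have := edge_split eam va bm; have := edge_dist v ema; dlia.
Qed.

Lemma geodesic_uniq x y z z' :
  d x y = d x z + d z y -> d x y = d x z' + d z' y -> d x z = d x z' -> z = z'.
Proof.
move En: (d x z) => n; elim: n x z z' En => [|n IHn] x z z' xz dz dz' xz'.
  by rewrite -(dist_eq0 xz) (dist_eq0 (esym xz')).
have [|a exa da] := @dist_step x z; first by rewrite -dist_gt0; dlia.
have [|b exb db] := @dist_step x z'; first by rewrite -dist_gt0; dlia.
have ay : d a y < d x y by have := dist_triangle z a y; dlia.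
have by' : d b y < d x y by have := dist_triangle z' b y; dlia.
have eqab : a = b by apply: (@toward_uniq x a b y); rewrite // !(dist_sym y).
rewrite -eqab in exb db by'.
have := dist_triangle a x y; rewrite (edge_dist1 exa).
have := dist_triangle z a y; have := dist_triangle z' a y => *.
apply: (IHn a z z'); dlia.
Qed.

(** Trees are bipartite: each edge changes the distance to [v] by exactly one. *)
Lemma dist_parity x y v : odd (d x y) = odd (d x v) (+) odd (d y v).
Proof.
move En: (d x y) => n; elim: n x En => [|n IHn] x dxy.
  by rewrite (dist_eq0 dxy) addbb.
have [|z exz dz] := @dist_step x y; first by rewrite -dist_gt0; dlia.
rewrite /= (IHn z); last dlia.
have := edge_dist v exz; rewrite !(dist_sym v); dlia.
Qed.

(** * Degrees and the legs of major vertices *)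

Lemma nonmajor_nbr z n1 n2 v : ~~ major e z -> e z n1 -> e z n2 -> n1 != n2 ->
  e z v -> v = n1 \/ v = n2.
Proof.
move=> nmaj ez1 ez2 neq ezv; apply/set2P; apply: contraNT nmaj => nv.
have: v |: [set n1; n2] \subset [set w | e z w].
  by apply/subsetP=> w; rewrite !inE => /or3P[] /eqP->.
by move/subset_leq_card; rewrite cardsU1 nv cards2 neq.
Qed.

Lemma end_vertex_nbr u n1 n2 : end_vertex e u -> e u n1 -> e u n2 -> n1 = n2.
Proof.
case/cards1P=> x defx eu1 eu2.
have: n1 \in [set w | e u w] by rewrite inE.
have: n2 \in [set w | e u w] by rewrite inE.
by rewrite defx => /set1P-> /set1P->.
Qed.

Lemma major_nbrs w b : major e w ->
  exists n1 n2, [/\ e w n1, e w n2, n1 != n2, n1 != b & n2 != b].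
Proof.
rewrite /major /degree (cardsD1 b) => maj.
have: 1 < #|[set v | e w v] :\ b| by move: maj; case: (_ \in _); dlia.
case/card_gt1P=> n1 [n2 []]; rewrite !inE => /andP[nb1 e1] /andP[nb2 e2] neq.
by exists n1, n2.
Qed.

(** Metric betweenness encodes the path; for a terminal vertex [u] of [w], the leg contains [u] but
    not [w]. *)
Definition leg u w : {set T} := [set z | (z != w) && (d u w == d u z + d z w)].

Lemma leg_nonmajor u w z : terminal e u w -> z \in leg u w -> ~~ major e z.
Proof.
case/and3P=> _ _ /forallP/(_ z) far; rewrite inE => /andP[neq /eqP duw].
by apply/negP=> maj; rewrite maj neq /= in far; dlia.
Qed.

Lemma terminal_neq u w : terminal e u w -> u != w.
Proof.
case/and3P=> /eqP endu maj _; apply/eqP=> equw.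
by move: maj; rewrite /major -equw endu.
Qed.

(** The leg fills its whole branch at [w]: no leg vertex [v] is major, so a neighbour of [v] away
    from [w] can only be the one toward [u], and [u] itself has none. *)
Lemma leg_branch u w a z : terminal e u w -> e w a -> d u a < d u w ->
  (z \in leg u w) = (d z a < d z w).
Proof.
move=> tuw ewa ua; have eaw : e a w by rewrite sym.
apply/idP/idP => [|za].
  rewrite inE -dist_gt0 => /andP[zw /eqP duw]; have [dzw | dzw] := edge_dist z ewa; first dlia.
  have := edge_split eaw ua (y := z); have := edge_dist u ewa; rewrite dzw ltnSn => ? /(_ isT); dlia.
move En: (d z a) => n; elim: n z za En => [|n IHn] z za dza.
  rewrite (dist_eq0 dza) inE -dist_gt0 (edge_dist1 eaw) /=.
  have := edge_dist u ewa; dlia.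
have [|v ezv dv] := @dist_step z a; first by rewrite -dist_gt0; dlia.
have evz : e v z by rewrite sym.
have va : d v a < d v w.
  have := edge_dist v ewa; have := dist_triangle v z w; rewrite (edge_dist1 ezv); dlia.
have vleg : v \in leg u w by apply: IHn => //; dlia.
have nmaj := leg_nonmajor tuw vleg.
move: vleg; rewrite inE -dist_gt0 => /andP[vw /eqP duw].
have [|n1 evn1 dn1] := @dist_step v w; first by rewrite -dist_gt0.
have zw : d z w = (d v w).+1 by have := edge_dist z ewa; have := edge_dist v ewa; dlia.
have [equv | nuv] := eqVneq u v.
  have /and3P[endu _ _] := tuw; rewrite equv in endu.
  by move: zw dn1; rewrite (end_vertex_nbr endu evz evn1); dlia.
have [|n2 evn2 dn2] := @dist_step v u; first by rewrite eq_sym.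
have n12 : n1 != n2.
  apply/eqP=> eqn; rewrite -eqn in dn2.
  have := dist_triangle n1 u w; rewrite (dist_sym u n1); rewrite (dist_sym u v) in duw; dlia.
have [eqz | eqz] := nonmajor_nbr nmaj evn1 evn2 n12 evz; first by move: dn1 zw; rewrite eqz; dlia.
rewrite inE -dist_gt0 zw /=; move: zw duw; rewrite eqz !(dist_sym u); dlia.
Qed.

(** The first edge of the leg at [w] separates the leg from all other vertices. *)
Lemma leg_out u w z v : terminal e u w -> z \in leg u w -> v \notin leg u w ->
  d z v = d z w + d w v.
Proof.
move=> tuw; have nuw := terminal_neq tuw.
have [|a ewa da] := @dist_step w u; first by rewrite eq_sym.
have ua : d u a < d u w by rewrite !(dist_sym u); dlia.
have eaw : e a w by rewrite sym.
rewrite !(leg_branch _ tuw ewa ua) => za va.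
have wv : d v w < d v a by have := edge_dist v ewa; dlia.
rewrite (edge_split eaw za wv) (dist_sym w v); have := edge_dist z ewa; dlia.
Qed.

Lemma leg_disjoint u w u' w' z : terminal e u w -> terminal e u' w' ->
  z \in leg u w -> z \in leg u' w' -> u = u' /\ w = w'.
Proof.
(* Each of [w], [w'] is major, hence off the other's leg; [leg_out] used both ways forces
   [d w w' = 0]. *)
move=> tuw tuw' zl zl'; have eqw : w = w'.
  have maj_out v1 w1 w2 : terminal e v1 w1 -> major e w2 -> w2 \notin leg v1 w1.
    by move=> t1; apply: contraL => /(leg_nonmajor t1).
  have /and3P[_ majw _] := tuw; have /and3P[_ majw' _] := tuw'.
  have := leg_out tuw zl (maj_out _ _ _ tuw majw').
  have := leg_out tuw' zl' (maj_out _ _ _ tuw' majw); rewrite (dist_sym w' w) => *.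
  apply: dist_eq0; dlia.
rewrite -eqw in tuw' zl' *; split=> //; apply/eqP/idPn=> neq.
(* Two legs of [w] with a common vertex start with the same edge, so [u'] would lie strictly between
   [u] and [w] and have two neighbours. *)
have [|a ewa da] := @dist_step w u; first by rewrite eq_sym (terminal_neq tuw).
have [|b ewb db] := @dist_step w u'; first by rewrite eq_sym (terminal_neq tuw').
have ua : d u a < d u w by rewrite !(dist_sym u); dlia.
have ub : d u' b < d u' w by rewrite !(dist_sym u'); dlia.
rewrite (leg_branch _ tuw ewa ua) in zl; rewrite (leg_branch _ tuw' ewb ub) in zl'.
rewrite -(toward_uniq ewa ewb zl zl') -(leg_branch _ tuw ewa ua) in ub.
have nuw' := terminal_neq tuw'; have /and3P[endu _ _] := tuw'.
move: ub; rewrite inE => /andP[_ /eqP duw].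
have [n1 e1 d1] := @dist_step u' w nuw'.
have [|n2 e2 d2] := @dist_step u' u; first by rewrite eq_sym.
rewrite -(end_vertex_nbr endu e1 e2) (dist_sym n1) in d2.
have := dist_triangle n1 u w; move: duw; rewrite (dist_sym u u') d1 d2; dlia.
Qed.

(** The vertex of the branch farthest from [m] is an end vertex; all other major vertices are
    outside the branch, so it reaches them through [m]. *)
Lemma branch_leg m a : major e m -> e m a ->
  (forall v, d v a < d v m -> ~~ major e v) -> exists2 u, terminal e u m & d u a < d u m.
Proof.
move=> majm ema nmaj; have eam : e a m by rewrite sym.
have da : d a a < d a m by rewrite dist_refl (edge_dist1 eam).
case: (@arg_maxnP _ a (fun v => d v a < d v m) (fun v => d v m) da) => u ua umax.
exists u => //; apply/and3P; split=> //; last first.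
  apply/forallP=> w; apply/implyP=> /andP[majw wm].
  have wma : d w m < d w a.
    by have := edge_dist w ema; have := contraL (nmaj w) majw; dlia.
  rewrite (edge_split eam ua wma); have := edge_dist u ema.
  by move: wm; rewrite -dist_gt0; dlia.
have um : u != m by rewrite -dist_gt0; dlia.
have [n eun dn] := dist_step um.
apply/cards1P; exists n; apply/setP=> v; rewrite !inE.
apply/idP/eqP => [euv | -> //].
have [vm | mv] := ltnP (d m v) (d m u).
  by apply: (toward_uniq euv eun vm); rewrite !(dist_sym m); dlia.
have dvm : d v m = (d u m).+1 by have := edge_dist m euv; rewrite !(dist_sym m) in mv *; dlia.
have [va | av] := ltnP (d v a) (d v m); first by have := umax v va; rewrite /= dvm; dlia.
have vma : d v m < d v a by have := edge_dist v ema; dlia.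
have := edge_split eam ua vma; rewrite (edge_dist1 euv); dlia.
Qed.

(** Take a major vertex [w] of the branch farthest from [m]: its branches not toward [m] contain no
    major vertex, so each is a leg, and there are at least two. *)
Lemma branch_Mset m a w0 : e m a -> major e w0 -> d w0 a < d w0 m ->
  exists2 w, w \in Mset e & d w a < d w m.
Proof.
move=> ema maj0 d0; have eam : e a m by rewrite sym.
have P0 : major e w0 && (d w0 a < d w0 m) by rewrite maj0.
case: (@arg_maxnP _ w0 (fun v => major e v && (d v a < d v m)) (fun v => d v m) P0).
move=> w /andP[majw wa] wmax; exists w => //.
have [|b ewb db] := @dist_step w m; first by rewrite -dist_gt0; dlia.
have [n1 [n2 [e1 e2 n12 n1b n2b]]] := major_nbrs b majw.
have term n : e w n -> n != b -> exists2 u, terminal e u w & d u n < d u w.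
  move=> ewn nb; apply: branch_leg => // v vn; apply/negP=> majv.
  have mw : d m w < d m n.
    have [dmw | dmw] := edge_dist m ewn; last dlia.
    case/eqP: nb; apply: (toward_uniq ewn ewb (v := m)); rewrite !(dist_sym m) in dmw *; dlia.
  have enw : e n w by rewrite sym.
  have dvm := edge_split enw vn mw; have := edge_dist v ewn => dvw.
  have va : d v a < d v m.
    have [dva | dva] := edge_dist v ema; first dlia.
    have vm : d v m < d v a by dlia.
    by have := edge_split eam wa vm; move: dvm; rewrite (dist_sym m w) (dist_sym w v); dlia.
  have := wmax v; rewrite /= majv va => /(_ isT); rewrite dvm (dist_sym m w); dlia.
have [u1 t1 d1] := term n1 e1 n1b; have [u2 t2 d2] := term n2 e2 n2b.
rewrite inE majw; apply/card_gt1P; exists u1, u2; rewrite !inE; split=> //.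
by apply: contraNneq n12 => equ; rewrite equ in d1; rewrite (toward_uniq e1 e2 d1 d2).
Qed.

(** * Distances to sets *)

Lemma dist_set_le (S : {set T}) a v : v \in S -> dist_set e a S <= d a v.
Proof. by move=> vS; apply/minseq_le/image_f. Qed.

Lemma dist_setP (S : {set T}) a v : v \in S -> exists2 s, s \in S & dist_set e a S = d a s.
Proof.
move=> vS; apply/imageP; apply: minseq_mem.
by apply: contraTneq (image_f (dist e a) vS) => ->.
Qed.

Lemma distinguishes_near (S : {set T}) x y v :
  v \in S -> (forall s, s \in S -> d x v < d y s) -> distinguishes e S x y.
Proof.
move=> vS near; have [s sS ds] := dist_setP y vS.
have := near s sS; have := dist_set_le x vS; rewrite /distinguishes ds; lia.
Qed.

Lemma distinguishes_sym (S : {set T}) x y : distinguishes e S x y = distinguishes e S y x.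
Proof. by rewrite /distinguishes eq_sym. Qed.

(** * The colouring of the legs *)

Section Colouring.

Variable k : nat.
Hypothesis k_le : k <= varsigma e.

Definition nearest_terminal w := odflt w [pick u in terminals e w | d u w == lmin e w].

Definition terminal_seq w :=
  nearest_terminal w :: enum (terminals e w :\ nearest_terminal w).

Definition rank w u := index u (terminal_seq w).

Definition quota w j :=
  if j == 0 then minn (lmin e w) k./2 else k - minn (lmin e w) k./2.

Definition coloured u w z :=
  [&& w \in Mset e, terminal e u w, z \in leg u w & d z w <= quota w (rank w u)].

(** The offset numbers the private colours of [w] consecutively over its first two legs. From rank 2
    on [w] is not recorded, so different major vertices share these colours. *)
Definition code u w z : T * nat + nat * nat :=
  if rank w u < 2 then inl (w, rank w u * quota w 0 + d z w)
  else inr (rank w u, d z w).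

Definition colour z : option (T * nat + nat * nat) :=
  if [pick p | coloured p.1 p.2 z] is Some p then Some (code p.1 p.2 z) else None.

Lemma Mset_terminal w : w \in Mset e -> exists u, terminal e u w.
Proof.
rewrite inE => /andP[_ ter_w]; have /card_gt0P[u] : 0 < ter e w by lia.
by rewrite inE; exists u.
Qed.

Lemma nearest_terminalP w : w \in Mset e ->
  terminal e (nearest_terminal w) w /\ d (nearest_terminal w) w = lmin e w.
Proof.
move=> Mw; rewrite /nearest_terminal; case: pickP => /= [u | none].
  by rewrite inE => /andP[? /eqP].
have [u0 t0] := Mset_terminal Mw.
have : lmin e w \in [seq d u w | u in terminals e w].
  apply: minseq_mem; have u0t : u0 \in terminals e w by rewrite inE.
  by apply: contraTneq (image_f (fun u => d u w) u0t) => ->.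
by case/imageP=> u ut lw; have := none u; rewrite ut lw eqxx.
Qed.

Lemma terminal_seq_mem u w : terminal e u w -> u \in terminal_seq w.
Proof. by move=> tu; rewrite inE mem_enum !inE tu andbT orbN. Qed.

Lemma rank_inj w u u' : terminal e u w -> terminal e u' w -> rank w u = rank w u' -> u = u'.
Proof. by move=> tu tu'; apply: (index_inj u); apply: terminal_seq_mem. Qed.

Lemma rank_lt u w : w \in Mset e -> terminal e u w -> rank w u < ter e w.
Proof.
move=> Mw tu; have [t0 _] := nearest_terminalP Mw.
suff -> : ter e w = size (terminal_seq w) by rewrite index_mem terminal_seq_mem.
by rewrite /= -cardE /ter (cardsD1 (nearest_terminal w)) inE t0.
Qed.

Lemma terminal_dist_sum u u' w : w \in Mset e -> terminal e u w -> terminal e u' w ->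
  u != u' -> k <= d u w + d u' w.
Proof.
move=> Mw tu tu' neq; apply: leq_trans k_le _.
apply: (@leq_trans (varsigma_vertex e w)); apply: minseq_le; first exact: image_f.
by apply: (image_f (fun p : T * T => d p.1 w + d p.2 w) (x := (u, u'))); rewrite !inE tu tu'.
Qed.

(** A leg other than the chosen shortest one has length at least [k - lmin e w] and at least
    [lmin e w]; the first bound serves when [lmin e w <= k./2], the second otherwise. *)
Lemma quota_le u w : w \in Mset e -> terminal e u w -> quota w (rank w u) <= d u w.
Proof.
move=> Mw tu; have [t0 d0] := nearest_terminalP Mw.
have lw : lmin e w <= d u w by apply/minseq_le/(image_f (fun v => d v w)); rewrite inE.
rewrite /quota /rank /=; have [_ | neq] /= := eqVneq (nearest_terminal w) u; first by rewrite geq_min lw.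
have := terminal_dist_sum Mw t0 tu neq; rewrite d0; dlia.
Qed.

Lemma quota_sum w j j' : j != j' -> k <= quota w j + quota w j'.
Proof. by rewrite /quota; case: j j' => [|j] [|j'] //=; lia. Qed.

Lemma quota0_le w : quota w 0 <= k.
Proof. rewrite /quota /=; lia. Qed.

Lemma colourE u w z : coloured u w z -> colour z = Some (code u w z).
Proof.
move=> cz; rewrite /colour; case: pickP => [[u' w'] /= cz' | /(_ (u, w)) /=]; last by rewrite cz.
case/and4P: cz => _ tu zl _; case/and4P: cz' => _ tu' zl' _.
by have [-> ->] := leg_disjoint tu tu' zl zl'.
Qed.

Lemma colour_inv c z : colour z = Some c -> exists u w, coloured u w z /\ code u w z = c.
Proof.
by rewrite /colour; case: pickP => // -[u w] /= cz [<-]; exists u, w.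
Qed.

Lemma leg_dist_inj u w z z' : z \in leg u w -> z' \in leg u w -> d z w = d z' w -> z = z'.
Proof.
rewrite !inE => /andP[_ /eqP dz] /andP[_ /eqP dz'] eqd.
apply: (geodesic_uniq (x := w) (y := u)); rewrite !(dist_sym w) ?(dist_sym _ u) //; lia.
Qed.

Lemma coloured_range u w z : coloured u w z -> 0 < d z w <= quota w (rank w u).
Proof. by case/and4P=> _ _; rewrite inE dist_gt0 => /andP[-> _] ->. Qed.

(** For a fixed [w], a colour determines the rank and the distance to [w], hence the vertex; so a
    repetition involves another major vertex and a shared colour, which records the distance. *)
Lemma same_colour u w z s : coloured u w z -> colour s = colour z -> s != z ->
  exists u' w', [/\ coloured u' w' s, w' != w & d s w' = d z w].
Proof.
move=> cz; rewrite (colourE cz) => /colour_inv[u' [w' [cs eqc]]] neq.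
suff [nw eqd] : w' != w /\ d s w' = d z w by exists u', w'.
have := coloured_range cs; have := coloured_range cz; move: eqc.
case/and4P: (cz) => Mw tu zl _; case/and4P: (cs) => Mw' tu' sl _.
rewrite /code; case: ifP => r2; case: ifP => r2' // [].
  move=> eqw; rewrite eqw in r2 tu' sl * => eqd rz rs; case/eqP: neq.
  have eqr : rank w u' = rank w u.
    move: r2 r2' eqd rz rs; case: (rank w u') => [|[|//]]; case: (rank w u) => [|[|//]] //=; dlia.
  apply: (@leg_dist_inj u w) => //; first by rewrite -(rank_inj tu' tu eqr).
  by move: eqd; rewrite eqr; dlia.
move=> eqr eqd _ _; split=> //; apply: contraNneq neq => eqw; rewrite eqw in eqr tu' sl eqd.
by apply/eqP/(@leg_dist_inj u w); rewrite // -(rank_inj tu' tu eqr).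
Qed.

(** * Colour classes distinguish every pair of vertices *)

Definition colour_class v := [set s | colour s == colour v].

Definition colour_partition := preim_partition colour [set: T].

Lemma colour_class_in v : colour_class v \in colour_partition.
Proof.
by apply/imsetP; exists v; rewrite // /colour_class; apply/setP=> s; rewrite !inE eq_sym.
Qed.

(** By [quota_le] the leg is long enough to have a vertex at each distance from 1 to the quota. *)
Lemma card_quota u w : w \in Mset e -> terminal e u w ->
  quota w (rank w u) <= #|[set z | coloured u w z]|.
Proof.
move=> Mw tu; rewrite -{1}(size_iota 1 (quota _ _)) cardE -(size_map (fun z => d z w)).
apply: uniq_leq_size (iota_uniq _ _) _ => i; rewrite mem_iota => /andP[i_gt0 i_le].
have iu : i <= d w u by rewrite dist_sym; have := quota_le Mw tu; dlia.
have [z dz dwu] := geodesic_point iu.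
apply/mapP; exists z; last by rewrite dist_sym.
rewrite mem_enum !inE /coloured Mw tu !inE -dist_gt0 (dist_sym z w) dz i_gt0.
rewrite (dist_sym u w) dwu (dist_sym u z) addnC eqxx /=; dlia.
Qed.

(** The two legs carry at least [k] coloured vertices, and no colour repeats among them, since that
    would require another major vertex. *)
Lemma two_legs_distinguish u u' w x y : w \in Mset e -> terminal e u w -> terminal e u' w ->
  u != u' ->
  (forall v, coloured u w v || coloured u' w v -> distinguishes e (colour_class v) x y) ->
  k <= #|[set S in colour_partition | distinguishes e S x y]|.
Proof.
move=> Mw tu tu' neq dis; set Z := [set z | coloured u w z || coloured u' w z].
have kZ : k <= #|Z|.
  have -> : Z = [set z | coloured u w z] :|: [set z | coloured u' w z].
    by apply/setP=> z; rewrite !inE.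
  rewrite cardsU (_ : _ :&: _ = set0) ?cards0 ?subn0.
    apply: leq_trans (leq_add (card_quota Mw tu) (card_quota Mw tu')).
    by apply: quota_sum; apply: contra_neq neq => /(rank_inj tu tu').
  apply/setP=> z; rewrite !inE; apply/negP=> /andP[/and4P[_ _ zl _] /and4P[_ _ zl' _]].
  by have [equ _] := leg_disjoint tu tu' zl zl'; rewrite equ eqxx in neq.
have inj : {in Z &, injective colour_class}.
  move=> z s; rewrite !inE => cz cs eqcls; apply/eqP; rewrite eq_sym; apply/idPn=> nsz.
  have eqcol : colour s = colour z.
    have: s \in colour_class s by rewrite /colour_class inE.
    by rewrite -eqcls /colour_class inE => /eqP.
  have [u1 c1] : exists u1, coloured u1 w z by case/orP: cz => cz; [exists u | exists u'].
  have [u2 [w2 [/and4P[_ t2 s2 _] nw _]]] := same_colour c1 eqcol nsz.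
  case/orP: cs => /and4P[_ t sl _]; have [_ eqw] := leg_disjoint t t2 sl s2;
    by rewrite eqw eqxx in nw.
apply: leq_trans kZ _; rewrite -(card_in_imset inj); apply/subset_leq_card/subsetP=> S.
by case/imsetP=> v; rewrite [v \in Z]inE => cv ->; rewrite inE colour_class_in dis.
Qed.

Lemma private_colour u w v s : coloured u w v -> rank w u < 2 -> colour s = colour v -> s = v.
Proof.
move=> cv r2 eqcol; apply/eqP/idPn=> nsv.
have [u' [w' [cs nw _]]] := same_colour cv eqcol nsv.
move: eqcol; rewrite (colourE cv) (colourE cs) /code r2; case: ifP => // _ [eqw _].
by rewrite eqw eqxx in nw.
Qed.

Lemma private_terminals w : w \in Mset e -> exists u u',
  [/\ terminal e u w, terminal e u' w, u != u', rank w u < 2 & rank w u' < 2].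
Proof.
move=> Mw; have [t0 _] := nearest_terminalP Mw.
have: 0 < #|terminals e w :\ nearest_terminal w|.
  move: Mw; rewrite inE /ter (cardsD1 (nearest_terminal w)) inE t0; lia.
rewrite cardE; case E1: (enum _) => [//|u1 s] _.
have: u1 \in terminals e w :\ nearest_terminal w by rewrite -mem_enum E1 mem_head.
rewrite !inE => /andP[n10 t1]; exists (nearest_terminal w), u1.
rewrite t0 t1 eq_sym n10 /rank /terminal_seq E1 /= !eqxx; split=> //.
by case: ifP.
Qed.

Lemma singleton_distinguishes x y v : (forall s, colour s = colour v -> s = v) ->
  d x v != d y v -> distinguishes e (colour_class v) x y.
Proof.
move=> sing; have vcls : v \in colour_class v by rewrite /colour_class inE.
have near x' y' s : d x' v < d y' v -> s \in colour_class v -> d x' v < d y' s.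
  by rewrite /colour_class inE => lt /eqP/sing->.
rewrite neq_ltn => /orP[lt|lt]; last rewrite distinguishes_sym;
  by apply: (distinguishes_near vcls) => s; apply: near.
Qed.

(* A vertex [s != v] of the colour of [v] lies at distance [d v m] from another major vertex,
   hence further than that from [m]. *)
Lemma legs_distinguish u u' m x y v : terminal e u' m -> u != u' -> y \in leg u' m ->
  coloured u m v -> d x v < d y m + d m v -> distinguishes e (colour_class v) x y.
Proof.
move=> tu' neq yl cv lt; apply: (distinguishes_near (v := v)); first by rewrite /colour_class inE.
move=> s; rewrite /colour_class inE => /eqP eqcol; have [_ tu vl _] := and4P cv.
have [-> | nsv] := eqVneq s v.
  rewrite (leg_out tu' yl) //; apply/negP=> vl'.
  by have [equ _] := leg_disjoint tu tu' vl vl'; rewrite equ eqxx in neq.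
have [u2 [w2 [cs nw ds]]] := same_colour cv eqcol nsv; have [_ t2 sl _] := and4P cs.
rewrite (leg_out tu' yl); last first.
  by apply/negP=> sl'; have [_ eqw] := leg_disjoint t2 tu' sl sl'; rewrite eqw eqxx in nw.
have mout : m \notin leg u2 w2.
  have /and3P[_ majm _] := tu; exact: contraL (leg_nonmajor t2) majm.
have := leg_out t2 sl mout; rewrite (dist_sym m v) in lt; rewrite (dist_sym m s); dlia.
Qed.

(** From [x] to [v] both crossings of the edge [ma] are saved, while [y] reaches [v] only through
    [m]. *)
Lemma branch_nearer x y m a v : e m a -> d m x = (d a x).+1 -> d m y = d m x ->
  d x y = d x m + d m y -> d v a < d v m -> d x v < d y m + d m v /\ d x v < d y v.
Proof.
move=> ema dx dy dxy va; have eam : e a m by rewrite sym.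
have ym : d y m < d y a.
  have := edge_dist y ema; have := dist_triangle a x y.
  by rewrite (dist_sym a y); move: dx dy dxy; rewrite !(dist_sym x) !(dist_sym m y); dlia.
have := edge_split eam va ym; have := dist_triangle a x v; have := edge_dist v ema.
rewrite (dist_sym a v) (dist_sym y v) (dist_sym m v) (dist_sym x a).
by move: dx dy dxy; rewrite !(dist_sym x) !(dist_sym m y); dlia.
Qed.

Lemma colour_partition_generator : 0 < #|Mset e| -> k_partition_generator e k colour_partition.
Proof.
case/card_gt0P=> w0 Mw0; rewrite /k_partition_generator preim_partitionP /=.
apply/forallP=> x; apply/forallP=> y; apply/implyP=> nxy.
have by_private w : w \in Mset e ->
    (forall u v, terminal e u w -> v \in leg u w -> d x v != d y v) ->
    k <= #|[set S in colour_partition | distinguishes e S x y]|.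
  move=> Mw far; have [u [u' [tu tu' neq r r']]] := private_terminals Mw.
  apply: (two_legs_distinguish Mw tu tu' neq) => v.
  have one u1 : rank w u1 < 2 -> coloured u1 w v -> distinguishes e (colour_class v) x y.
    move=> r1 cv; apply: singleton_distinguishes => [s|]; first exact: private_colour cv r1.
    by have /and4P[_ t1 vl _] := cv; apply: far t1 vl.
  by case/orP; apply: one.
have [odd_xy | even_xy] := boolP (odd (d x y)).
  apply: (by_private w0) => // _ v _ _; apply: contraTneq odd_xy => eqd.
  by rewrite (dist_parity _ _ v) eqd addbb.
have [|m xm my] := @geodesic_point x y (d x y)./2; first lia.
have hm : d m y = d m x by move: xm my even_xy; rewrite (dist_sym m x); lia.
have h_gt0 : 0 < d m x by move: nxy; rewrite -dist_gt0 -hm; move: my; rewrite (dist_sym x m) in xm; dlia.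
have [|a ema dax] := @dist_step m x; first by rewrite -dist_gt0.
have [|b emb dby] := @dist_step m y; first by rewrite -dist_gt0 hm.
have dxy : d x y = d x m + d m y by dlia.
have dyx : d y x = d y m + d m x by rewrite (dist_sym y x) (dist_sym y m) -hm dxy (dist_sym x m) hm.
have hm' := esym hm.
have nab : a != b.
  apply/eqP=> eqab; rewrite -eqab in dby; have := dist_triangle a x y.
  by move: dxy; rewrite (dist_sym x m) (dist_sym x a); dlia.
have near_a v := branch_nearer ema dax hm dxy (v := v).
have near_b v := branch_nearer emb dby hm' dyx (v := v).
have branches v : (d v a < d v m) || (d v b < d v m) -> d x v != d y v.
  by case/orP=> [/near_a[_] | /near_b[_]]; rewrite neq_ltn => ->; rewrite ?orbT.
(* A non-major [m] has only the neighbours [a] and [b]. *)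
have two_branches v : ~~ major e m -> v != m -> (d v a < d v m) || (d v b < d v m).
  move=> nmaj nvm; have [|n emn dn] := @dist_step m v; first by rewrite eq_sym.
  have ltn_v : d v n < d v m by rewrite !(dist_sym v) dn.
  by have [<-|<-] := nonmajor_nbr nmaj ema emb nab emn; rewrite ltn_v ?orbT.
(* Legs of [w] not containing [m] stay in the branch of [w]. *)
have avoid w : w \in Mset e -> (d w a < d w m) || (d w b < d w m) ->
    (forall u, terminal e u w -> m \notin leg u w) ->
    k <= #|[set S in colour_partition | distinguishes e S x y]|.
  move=> Mw wab mout; apply: (by_private w Mw) => u v tu vl; apply: branches.
  rewrite (leg_out tu vl (mout u tu)).
  have := dist_triangle w v a; have := dist_triangle w v b; case/orP: wab; dlia.
have [/existsP[w1 /andP[M1 /existsP[u1 /andP[t1 ml]]]] | nleg] :=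
    boolP [exists w, (w \in Mset e) && [exists u, terminal e u w && (m \in leg u w)]].
  have nmaj := leg_nonmajor t1 ml.
  have [/existsP[w2 /andP[M2 n21]] | only] := boolP [exists w, (w \in Mset e) && (w != w1)].
    have nw2m : w2 != m by apply: contraNneq nmaj => <-; move: M2; rewrite inE => /andP[].
    apply: (avoid w2 M2 (two_branches w2 nmaj nw2m)) => u t2; apply/negP=> ml2.
    by have [_ eqw] := leg_disjoint t1 t2 ml ml2; rewrite eqw eqxx in n21.
  have onlyM w : w \in Mset e -> w = w1.
    by move=> Mw; apply/eqP; apply: contraNT only => nw; apply/existsP; exists w; rewrite Mw.
  have /andP[maj1 _] : major e w1 && (1 < ter e w1) by rewrite inE in M1.
  (* A major vertex beyond a neighbour of [w1] would yield a second member of [Mset e]. *)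
  have only_major n v : e w1 n -> d v n < d v w1 -> ~~ major e v.
    move=> e1n vn; apply/negP=> majv; have [w Mw] := branch_Mset e1n majv vn.
    by rewrite (onlyM w Mw) dist_refl.
  have [|n0 e0 d0] := @dist_step w1 u1; first by rewrite eq_sym (terminal_neq t1).
  have d0' : d u1 n0 < d u1 w1 by rewrite !(dist_sym u1) d0.
  (* The leg through [m] starts at [n0]; two other neighbours of [w1] start legs that avoid [m]. *)
  have [n2 [n3 [e2 e3 n23 n20 n30]]] := major_nbrs n0 maj1.
  have [u2 t2 d2] := branch_leg maj1 e2 (fun v => only_major n2 v e2).
  have [u3 t3 d3] := branch_leg maj1 e3 (fun v => only_major n3 v e3).
  have neq v2 v3 k2 k3 : e w1 k2 -> e w1 k3 -> d v2 k2 < d v2 w1 -> d v3 k3 < d v3 w1 ->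
      k2 != k3 -> v2 != v3.
    by move=> ? ? l2 l3; apply: contra_neq => eqv; rewrite -eqv in l3; apply: toward_uniq l2 l3.
  apply: (two_legs_distinguish M1 t2 t3 (neq _ _ _ _ e2 e3 d2 d3 n23)) => v cv.
  have [u4 [c4 n41]] : exists u4, coloured u4 w1 v /\ u4 != u1.
    case/orP: cv => cv; [exists u2 | exists u3]; split=> //.
      exact: (neq _ _ _ _ e2 e0 d2 d0' n20).
    exact: (neq _ _ _ _ e3 e0 d3 d0' n30).
  apply: singleton_distinguishes => [s eqs|].
    apply/eqP/idPn=> nsv; have [u' [w' [/and4P[Mw' _ _ _] nw _]]] := same_colour c4 eqs nsv.
    by rewrite (onlyM w' Mw') eqxx in nw.
  apply/branches/two_branches => //; apply: contraNneq n41 => eqv.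
  have /and4P[_ t4 vl _] := c4; rewrite eqv in vl.
  by have [-> _] := leg_disjoint t4 t1 vl ml.
have mout w : w \in Mset e -> forall u, terminal e u w -> m \notin leg u w.
  move=> Mw u tu; apply: contraNN nleg => ml; apply/existsP; exists w; rewrite Mw.
  by apply/existsP; exists u; rewrite tu.
have [/existsP[w /andP[Mw wab]] | noM] :=
    boolP [exists w, (w \in Mset e) && ((d w a < d w m) || (d w b < d w m))].
  exact: avoid w Mw wab (mout w Mw).
have noMab w : w \in Mset e -> ~~ ((d w a < d w m) || (d w b < d w m)).
  by move=> Mw; apply: contraNN noM => wab; apply/existsP; exists w; rewrite Mw.
(* Otherwise the two branches would cover [w0]. *)
have majm : major e m.
  apply/idPn=> nmaj; case/negP: (noMab w0 Mw0); apply: two_branches => //.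
  by apply: contraNneq nmaj => <-; move: Mw0; rewrite inE => /andP[].
have [u tu ua] : exists2 u, terminal e u m & d u a < d u m.
  apply: branch_leg => // v va; apply/negP=> majv.
  by have [w /noMab] := branch_Mset ema majv va; rewrite negb_or => /andP[/negP].
have [u' tu' ub] : exists2 u, terminal e u m & d u b < d u m.
  apply: branch_leg => // v vb; apply/negP=> majv.
  by have [w /noMab] := branch_Mset emb majv vb; rewrite negb_or => /andP[_ /negP].
have nuu' : u != u'.
  by apply: contra_neq nab => equ; rewrite -equ in ub; apply: toward_uniq ua ub.
have Mm : m \in Mset e.
  by rewrite inE majm; apply/card_gt1P; exists u, u'; rewrite !inE.
have xl : x \in leg u m by rewrite (leg_branch _ tu ema ua) !(dist_sym x) dax.
have yl : y \in leg u' m by rewrite (leg_branch _ tu' emb ub) !(dist_sym y) dby.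
apply: (two_legs_distinguish Mm tu tu' nuu') => v /orP[] cv; have /and4P[_ _ vl _] := cv.
  rewrite (leg_branch _ tu ema ua) in vl.
  by apply: (legs_distinguish tu' nuu' yl cv); have [] := near_a v vl.
rewrite (leg_branch _ tu' emb ub) in vl; rewrite distinguishes_sym eq_sym in nuu' *.
by apply: (legs_distinguish tu nuu' xl cv); have [] := near_b v vl.
Qed.

(** * Counting the colours *)

Lemma card_colour_partition L : (forall v, colour v \in L) -> #|colour_partition| <= size L.
Proof.
move=> colL; rewrite cardE -(size_map (fun c => [set s | colour s == c]) L).
apply: uniq_leq_size (enum_uniq _) _ => S; rewrite mem_enum => /imsetP[v _ ->].
by apply/mapP; exists (colour v) => //; apply/setP=> s; rewrite !inE eq_sym.
Qed.

(* [quota w j] is the same for all [j > 0]. *)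
Definition shared_quota j := \max_(w in Mset e | j < ter e w) quota w 2.

(** There are at most [k] private colours per member of [Mset e], at most [shared_quota j] shared
    ones for each rank [j] from 2 on, and the value [None]. *)
Lemma card_colour_partition_le t : (forall w, w \in Mset e -> ter e w <= t) ->
  #|colour_partition| <= k * #|Mset e| + \sum_(2 <= j < t) shared_quota j + 1.
Proof.
move=> ter_le.
set L1 : seq (T * nat + nat * nat) := [seq inl (w, i) | w <- enum (Mset e), i <- iota 1 k].
set L2 : seq (T * nat + nat * nat) :=
  [seq inr (j, i) | j <- index_iota 2 t, i <- iota 1 (shared_quota j)].
have -> : k * #|Mset e| + \sum_(2 <= j < t) shared_quota j + 1 = size (None :: map Some (L1 ++ L2)).
  rewrite /= size_map size_cat size_allpairs size_allpairs_dep size_iota -cardE mulnC addn1.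
  by congr (_ + _).+1; rewrite sumnE big_map; apply: eq_bigr => j _; rewrite size_iota.
apply: card_colour_partition => v; case Ec: (colour v) => [c|]; last exact: mem_head.
have [u [w [cv <-]]] := colour_inv Ec; have /andP[d_gt0 d_le] := coloured_range cv.
have /and4P[Mw tu _ _] := cv.
rewrite inE /=; apply: map_f; rewrite mem_cat /code; case: ltnP => [r2 | r2].
  apply/orP; left; apply: allpairs_f; rewrite ?mem_enum // mem_iota.
  have := quota0_le w; have := quota_sum w (isT : 0 != 1).
  move: d_le; rewrite /quota; case: (rank w u) r2 => [|[|//]] _ /=; dlia.
apply/orP; right; apply/allpairsPdep; exists (rank w u), (d v w); rewrite !mem_iota.
have rt := rank_lt Mw tu; split=> //; first by have := ter_le w Mw; lia.
rewrite d_gt0 add1n ltnS; apply: leq_trans (leq_bigmax_cond w _); last by rewrite Mw rt.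
by move: d_le; rewrite /quota; case: (rank w u) r2.
Qed.

(** Truncated subtraction covers [b <= a], matching the positive parts in [Ik]. *)
Lemma sum_nat_bound (C : nat -> nat) a b B : (forall j, a <= j < b -> C j <= B) ->
  \sum_(2 <= j < b) C j <= \sum_(2 <= j < a) C j + (b - a) * B.
Proof.
move=> CB; have [le_ba | lt_ab] := leqP b a.
  apply: leq_trans (leq_addr _ _); have [le2b | lt2b] := leqP 2 b; last by rewrite big_geq // ltnW.
  by rewrite (big_cat_nat le2b le_ba) leq_addr.
have -> : b = a + (b - a) by lia.
have : forall j, a <= j < a + (b - a) -> C j <= B by move=> j jab; apply: CB; lia.
rewrite addKn; elim: (b - a) => [|n IHn] CB'; first by rewrite addn0 leq_addr.
rewrite addnS; have [le2 | lt2] := leqP 2 (a + n); last by rewrite big_geq.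
rewrite big_nat_recr //= mulSn (addnC B) addnA; apply: leq_add; last by apply: CB'; lia.
by apply: IHn => j jab; apply: CB'; lia.
Qed.

(** * Comparison with the parameter [Ik] *)

Definition t_max i := \max_(1 <= j < i.+1) t_idx e j.

Definition l_index w := (index (lmin e w) (lvals e)).+1.

Lemma l_indexP w : w \in Mset e ->
  [/\ l_index w <= size (lvals e), l_idx e (l_index w) = lmin e w
    & ter e w <= t_idx e (l_index w)].
Proof.
move=> Mw; have lw : lmin e w \in lvals e by rewrite mem_sort mem_undup image_f.
have lE : l_idx e (l_index w) = lmin e w by rewrite /l_idx nth_index.
split=> //; first by rewrite /l_index index_mem.
by apply: leq_bigmax_cond; rewrite inE Mw lE eqxx.
Qed.

Lemma l_idx_mono i j : 0 < i -> i <= j <= size (lvals e) -> l_idx e i <= l_idx e j.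
Proof.
move=> i_gt0 /andP[le_ij lej]; apply: (sorted_leq_nth leq_trans leqnn);
  rewrite ?inE; try lia; exact/sort_sorted/leq_total.
Qed.

Lemma t_maxS i : t_max i.+1 = maxn (t_max i) (t_idx e i.+1).
Proof. by rewrite /t_max big_nat_recr. Qed.

Lemma t_idx_le_max i j : 0 < i <= j -> t_idx e i <= t_max j.
Proof. by move=> ij; apply: leq_bigmax_seq; rewrite // mem_index_iota. Qed.

Lemma shared_quota_le j B :
  (forall w, w \in Mset e -> j < ter e w -> k - minn (lmin e w) k./2 <= B) ->
  shared_quota j <= B.
Proof. by move=> quB; apply/bigmax_leqP => w /andP[]; apply: quB. Qed.

Lemma l_index_gt w i : w \in Mset e -> t_max i < ter e w -> i < l_index w.
Proof.
move=> Mw; have [_ _ tw] := l_indexP Mw; apply: contraLR; rewrite -!leqNgt => le_i.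
by apply: leq_trans tw _; apply: t_idx_le_max; rewrite le_i.
Qed.

(** The bound on [l_idx e i] starts at [i = 2] because [s_idx] is 1 even when the smallest value
    exceeds [k./2]. *)
Lemma s_idxP : 0 < #|Mset e| ->
  [/\ 0 < s_idx e k <= size (lvals e),
      forall i, 1 < i <= s_idx e k -> l_idx e i <= k./2
    & forall w, w \in Mset e -> s_idx e k < l_index w -> k./2 < lmin e w].
Proof.
case/card_gt0P=> w0 M0; have [r0 l0 _] := l_indexP M0.
have r_gt0 : 0 < size (lvals e) by apply: leq_trans r0.
rewrite /s_idx; case: ifP => [lt1 | ge1].
  split=> // [i /andP[]|w Mw _]; first by case: i => [|[|]].
  have [rw <- _] := l_indexP Mw; apply: leq_trans lt1 _.
  by apply: l_idx_mono; rewrite ?rw.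
set s := \max_(_ <= i < _ | _) _.
have le_s i : 0 < i <= size (lvals e) -> l_idx e i <= k./2 -> i <= s.
  by move=> i_le li; apply: (leq_bigmax_seq (F := id)); rewrite // mem_index_iota ltnS.
have s_gt0 : 0 < s by apply: le_s; rewrite // leqNgt ge1.
have [s_le ls] : s <= size (lvals e) /\ l_idx e s <= k./2.
  move: s_gt0; rewrite /s big_seq_cond.
  (* The claim guarded by [0 < s] holds vacuously for the empty maximum and passes to maxima. *)
  elim/big_ind: _ => // [m n IHm IHn | i /andP[]]; first by rewrite /maxn; case: ifP.
  by rewrite mem_index_iota ltnS => /andP[].
split=> [|i /andP[i_gt1 i_le]|w Mw]; first by rewrite s_gt0.
  by apply: leq_trans ls; apply: l_idx_mono; rewrite ?i_le // ltnW.
have [rw <- _] := l_indexP Mw; apply: contraLR; rewrite -!leqNgt; exact: le_s.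
Qed.

(** The ranks are cut at the values [t_max i]: a leg of rank at least [t_max i] belongs to a vertex
    of [l_index] above [i], which bounds its quota. *)
Lemma sum_shared_quota : 0 < #|Mset e| ->
  \sum_(2 <= j < t_max (size (lvals e))) shared_quota j <= Ik e k.
Proof.
move=> M_gt0; have [/andP[s_gt0 s_le] ls slast] := s_idxP M_gt0.
rewrite /Ik; set s := s_idx e k in s_gt0 s_le ls slast *; set r := size (lvals e) in s_le *.
have prefix i : 0 < i <= s -> \sum_(2 <= j < t_max i) shared_quota j <=
    (t_idx e 1 - 2) * maxn (k - l_idx e 1) (uphalf k)
    + \sum_(2 <= i < i.+1) (t_idx e i - \max_(1 <= j < i) t_idx e j) * (k - l_idx e i).
  elim: i => // -[_ _|i IHi i_le].
    rewrite [X in _ + X]big_geq // addn0 /t_max big_nat1.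
    (* The first block has [t_idx e 1 - 2] ranks, as shared ranks start at 2. *)
    apply: leq_trans (sum_nat_bound (B := maxn (k - l_idx e 1) (uphalf k)) (a := 2) _) _.
      move=> j _; apply: shared_quota_le => w Mw _; have [rw lw _] := l_indexP Mw.
      have := @l_idx_mono 1 (l_index w) isT rw; rewrite lw; lia.
    by rewrite big_geq.
  rewrite [X in _ + X]big_nat_recr //= addnA.
  apply: leq_trans (leq_add (IHi _) (leqnn _)); last lia.
  have -> : t_idx e i.+2 - \max_(1 <= j < i.+2) t_idx e j = t_max i.+2 - t_max i.+1.
    by rewrite t_maxS -/(t_max _); lia.
  apply: sum_nat_bound => j /andP[jge _]; apply: shared_quota_le => w Mw jter.
  have iw := l_index_gt Mw (leq_ltn_trans jge jter); have [rw lw _] := l_indexP Mw.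
  have := @l_idx_mono i.+2 (l_index w) isT; rewrite iw rw lw => /(_ isT).
  have := ls i.+2; rewrite i_le => /(_ isT); lia.
have := prefix s; rewrite s_gt0 leqnn => /(_ isT) le_s.
apply: leq_trans (leq_add le_s (leqnn _)).
have -> : \max_(s.+1 <= j < r.+1) t_idx e j - \max_(1 <= j < s.+1) t_idx e j = t_max r - t_max s.
  have -> : t_max r = maxn (t_max s) (\max_(s.+1 <= j < r.+1) t_idx e j).
    by rewrite /t_max (big_cat_nat (n := s.+1) (p := r.+1)).
  by move: (\max_(s.+1 <= j < r.+1) _) => M; rewrite -/(t_max s); lia.
apply: sum_nat_bound => j /andP[jge _]; apply: shared_quota_le => w Mw jter.
(* Here [lmin e w > k./2], so the quota is [k - k./2 = uphalf k]. *)
have := slast w Mw (l_index_gt Mw (leq_ltn_trans jge jter)); lia.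
Qed.

End Colouring.
End Tree.
End Metric.

(** * Attainment of the minimum and the final bound *)

Theorem theorem26 (T : finType) (e : rel T) (k : nat) :
  is_tree e -> ~ is_path_graph e ->
  1 <= k <= varsigma e ->
  exists2 m : nat, is_pd e k m & m <= k * #|Mset e| + Ik e k + 1.
Proof.
case=> _ sym irr conn acyclic _ /andP[k_gt0 k_le].
(* With [Mset e] empty, [varsigma e] takes the default value 0, against [1 <= k]. *)
have M_gt0 : 0 < #|Mset e|.
  rewrite lt0n; apply: contraTneq k_gt0 => M0; rewrite -leqNgt.
  by move: k_le; rewrite /varsigma /image_mem; move/eqP: M0; rewrite cardE size_eq0 => /eqP->.
have gen := colour_partition_generator sym irr conn acyclic k_le M_gt0.
have ex_m : exists m, [exists P, k_partition_generator e k P && (#|P| == m)].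
  by exists #|colour_partition e k|; apply/existsP; exists (colour_partition e k); rewrite gen /=.
case: (ex_minnP ex_m) => m /existsP[P /andP[genP /eqP cardP]] m_min.
have m_le P' : k_partition_generator e k P' -> m <= #|P'|.
  by move=> gen'; apply: m_min; apply/existsP; exists P'; rewrite gen' /=.
exists m; first by split=> //; exists P.
apply: leq_trans (m_le _ gen) _.
apply: leq_trans (card_colour_partition_le conn k_le (t := t_max e (size (lvals e))) _) _.
  move=> w Mw; have [le_r _ tw] := l_indexP Mw.
  by apply: leq_trans tw _; apply: t_idx_le_max; rewrite le_r.
by rewrite leq_add2r leq_add2l sum_shared_quota.
Qed.
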